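(* Let $D$ be any squarefree integer, let $u$ be a positive integer, and let $S$ be the set of all numbers of the form $r+s\sqrt{D}$, where $r$ and $s$ are nonzero rational integers, $\gcd(r,sD)=1$, and $u\mid s$. Let $p$ be any odd prime number. Suppose there exists a positive integer $k$ such that $p^k$ or $-p^k$ is the norm of a number in $S$, and let $t$ be the least such positive integer. If $n$ is a positive integer such that $p^n$ or $-p^n$ is the norm of a number in $S$, then $t\mid n$.
   Context: The norm of $r+s\sqrt{D}$ is $r^2-Ds^2$. The signs for the exponents $t$ and $n$ are independent: for each exponent, either sign is allowed. Here $D$ may be positive or negative. *)

(* Defs.v *)
From mathcomp Require Import all_boot all_order all_algebra.
Set Implicit Arguments.
Unset Strict Implicit.
Unset Printing Implicit Defensive.
Import Order.TTheory GRing.Theory Num.Theory.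
Local Open Scope ring_scope.

(* 0 is not squarefree; 1 and -1 are. *)
Definition squarefreez (D : int) : Prop :=
  forall d : int, (d ^+ 2 %| D)%Z -> d \is a GRing.unit.

(* [Zsqrtd r s : zsqrtd D] is the number r + s * sqrt D.  For squarefree D <> 1
   the numbers r and s are determined by the value r + s * sqrt D, so this is
   the ring Z[sqrt D]; for D = 1 they are not, and the norm r^2 - D s^2 only
   makes sense for the expression r + s * sqrt D, which is what is kept here. *)
Record zsqrtd (D : int) : Type := Zsqrtd { zpart : int; sqrtpart : int }.

Definition normzd (D : int) (x : zsqrtd D) : int :=
  zpart x ^+ 2 - D * sqrtpart x ^+ 2.

Definition inS (D : int) (u : nat) (x : zsqrtd D) : Prop :=
  [/\ zpart x != 0,
      sqrtpart x != 0,
      coprimez (zpart x) (sqrtpart x * D)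
    & (u%:Z %| sqrtpart x)%Z].

Definition pm_pow_normS (D : int) (u p k : nat) : Prop :=
  exists x : zsqrtd D,
    inS u x /\ (normzd x = p%:Z ^+ k \/ normzd x = - p%:Z ^+ k).

Definition least_pos (P : nat -> Prop) (t : nat) : Prop :=
  [/\ (0 < t)%N, P t & forall k : nat, (0 < k)%N -> P k -> (t <= k)%N].

(* Main.v *)
Require Import Defs.
From mathcomp Require Import all_boot all_order all_algebra.
From mathcomp Require Import ring.
Import GRing.Theory Num.Theory.

(* Let x and y in S have norms +-p^t and +-p^n with t <= n.  The sqrt D parts of
   x y and x' y (x' the conjugate of x) have a product divisible by p^t, and p
   does not divide both of them, so p^t divides one; it then divides the whole of
   x y or x' y, and the quotient has norm +-p^(n-t).  If n > t, this quotient is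
   again in S: were p to divide it, p would divide y.  Descent on n concludes. *)

Section PrimePowerNorms.
Local Open Scope ring_scope.

Variables (D : int) (p : nat).
Hypothesis p_prime : prime p.

Lemma prime_dvdzM (x y : int) : (p %| x * y)%Z = (p %| x)%Z || (p %| y)%Z.
Proof. by rewrite !dvdzE abszM Euclid_dvdM. Qed.

Lemma prime_dvdzX2 (x : int) : (p %| x ^+ 2)%Z = (p %| x)%Z.
Proof. by rewrite expr2 prime_dvdzM orbb. Qed.

Lemma prime_coprimez (x : int) : coprimez p x = ~~ (p %| x)%Z.
Proof. by rewrite coprimezE dvdzE prime_coprime. Qed.

Lemma prime_pow_dvdzM (k : nat) (x y : int) :
  (p%:Z ^+ k %| x * y)%Z -> ~~ (p %| x)%Z -> (p%:Z ^+ k %| y)%Z.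
Proof.
by move=> xy_div nx; move: xy_div; rewrite Gauss_dvdzr // coprimezXl // prime_coprimez.
Qed.

Lemma dvdz_exp2r_imp (k : nat) (x : int) :
  (p%:Z ^+ k ^+ 2 %| x ^+ 2)%Z -> (p%:Z ^+ k %| x)%Z.
Proof. by rewrite !dvdzE !abszX dvdn_pexp2r. Qed.

(** The sign is a square root [e] of 1, so that signs multiply and cancel inside ring identities
    without case splits. *)
Definition norm_pm (a b : int) (k : nat) :=
  exists2 e : int, e ^+ 2 = 1 & a ^+ 2 - D * b ^+ 2 = e * p%:Z ^+ k.

(** Since [a] is prime to the norm, a Bezout relation between [a] and [a ^+ 2 - D * b ^+ 2] regroups
    into one between [a] and [b * D]. *)
Lemma norm_pm_coprimez (a b : int) (k : nat) : norm_pm a b k ->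
  ~~ (p %| a)%Z -> coprimez a (b * D).
Proof.
move=> [e e2 nab] na; have: coprimez a (e * p%:Z ^+ k).
  rewrite coprimezMr coprimezXr ?andbT; last by rewrite coprimez_sym prime_coprimez.
  by apply/coprimezP; exists (0, e); rewrite /= mul0r add0r -expr2.
rewrite -nab => /coprimezP[[x y] /= xy]; apply/coprimezP.
by exists (x + y * a, - y * b); rewrite /= -xy; ring.
Qed.

(** As [p] divides the norm, it divides [a] exactly when it divides [b * D]; coprimality excludes
    both at once. *)
Lemma coprimez_prime_ndvd (a b : int) (k : nat) : (0 < k)%N -> norm_pm a b k ->
  coprimez a (b * D) -> [/\ ~~ (p %| a)%Z, ~~ (p %| b)%Z & ~~ (p %| D)%Z].
Proof.
move=> k0 [e _ nab] co.
have pn : (p %| a ^+ 2 - D * b ^+ 2)%Z by rewrite nab dvdz_mull // dvdz_exp.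
have eq1 : (p %| a)%Z = (p %| b)%Z || (p %| D)%Z.
  rewrite -(prime_dvdzX2 a) -[a ^+ 2](subrK (D * b ^+ 2)).
  by rewrite rpredDl // prime_dvdzM prime_dvdzX2 orbC.
suff na : ~~ (p %| a)%Z by have:= na; rewrite {1}eq1 negb_or => /andP[].
apply/negP => pa; move: co => /coprimezP[[x y] /= xy].
have : (p %| 1%R)%Z by rewrite -xy rpredD // dvdz_mull // prime_dvdzM -eq1.
by rewrite dvdzE /= Euclid_dvd1.
Qed.

Lemma norm_pm_quotient (a b c d : int) (t m : nat) : (0 < t)%N -> (0 < m)%N ->
    norm_pm a b t -> coprimez a (b * D) ->
    norm_pm c d (t + m) -> coprimez c (d * D) ->
    (p%:Z ^+ t %| a * d - b * c)%Z ->
  exists r s : int, [/\ norm_pm r s m, coprimez r (s * D)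
    & a * d - b * c = s * p%:Z ^+ t].
Proof.
move=> t0 m0 nab coab ncd cocd /dvdzP[s sE].
have [na nb nD] := coprimez_prime_ndvd _ _ _ t0 nab coab.
have [nc nd _] := coprimez_prime_ndvd _ _ _ (ltn_addr m t0) ncd cocd.
move: nab ncd => [e e2 nab] [f f2 ncd].
(* Multiplicativity of the norm, applied to the conjugate of [a + b sqrt D] times [c + d sqrt D].
   The product of norms is [p ^ (2t + m)] up to sign, so [p ^ (2t)] divides the right-hand side. *)
have brahmagupta : (a * c - D * b * d) ^+ 2 =
    (a ^+ 2 - D * b ^+ 2) * (c ^+ 2 - D * d ^+ 2) + D * (a * d - b * c) ^+ 2.
  by ring.
have : (p%:Z ^+ t %| a * c - D * b * d)%Z.
  apply: dvdz_exp2r_imp; rewrite brahmagupta nab ncd sE exprMn exprD.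
  apply/dvdzP; exists (e * f * p%:Z ^+ m + D * s ^+ 2).
  by ring.
move=> /dvdzP[r rE].
have pt0 : p%:Z ^+ t != 0.
  by rewrite expf_neq0 // eqz_nat -lt0n prime_gt0.
have nrs : norm_pm r s m.
  exists (e * f); first by rewrite exprMn e2 f2 mulr1.
  apply: (mulIf (expf_neq0 2 pt0)); move: brahmagupta.
  rewrite nab ncd sE rE exprD => brE.
  transitivity ((r * p%:Z ^+ t) ^+ 2 - D * (s * p%:Z ^+ t) ^+ 2); first by ring.
  by rewrite brE; ring.
(* Because [m > 0] and [p] does not divide [D], [p] dividing [r] would force [p] to divide [s], and
   then [c]. *)
have nr : ~~ (p %| r)%Z.
  apply/negP => pr; case: (nrs) => g _ ng.
  have ps : (p %| s)%Z.
    have : (p %| D * s ^+ 2)%Z.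
      have -> : D * s ^+ 2 = r ^+ 2 - g * p%:Z ^+ m by rewrite -ng; ring.
      by rewrite rpredB ?prime_dvdzX2 // dvdz_mull // dvdz_exp.
    by rewrite prime_dvdzM prime_dvdzX2 (negPf nD).
  (* multiply the quotient back by [a + b sqrt D] to recover [c + d sqrt D] *)
  have cE : e * c = r * a + D * b * s.
    apply: (mulIf pt0); transitivity ((a ^+ 2 - D * b ^+ 2) * c).
      by rewrite nab; ring.
    transitivity (a * (r * p%:Z ^+ t) + D * b * (s * p%:Z ^+ t)); last by ring.
    by rewrite -rE -sE; ring.
  move: nc; have -> : c = e * (r * a + D * b * s).
    by rewrite -cE mulrA -expr2 e2 mul1r.
  by rewrite dvdz_mull // rpredD //; [exact: dvdz_mulr | exact: dvdz_mull].
by exists r, s; split=> //; exact: norm_pm_coprimez nrs nr.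
Qed.

Lemma norm_pm_descent (a b c d : int) (t m : nat) : odd p ->
    (0 < t)%N -> (0 < m)%N ->
    norm_pm a b t -> coprimez a (b * D) ->
    norm_pm c d (t + m) -> coprimez c (d * D) ->
  exists r s : int, [/\ norm_pm r s m, coprimez r (s * D)
    & a * d - b * c = s * p%:Z ^+ t \/ a * d + b * c = s * p%:Z ^+ t].
Proof.
move=> podd t0 m0 nab coab ncd cocd.
have [na nb nD] := coprimez_prime_ndvd _ _ _ t0 nab coab.
have [nc nd _] := coprimez_prime_ndvd _ _ _ (ltn_addr m t0) ncd cocd.
have pprod : (p%:Z ^+ t %| (a * d + b * c) * (a * d - b * c))%Z.
  case: (nab) (ncd) => [e _ nabE] [f _ ncdE]; apply/dvdzP.
  (* Eliminating [D] between the two norms: the product is [(a d)^2 - (b c)^2], the first norm times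
     [d^2] minus the second times [b^2]. *)
  exists (e * d ^+ 2 - f * p%:Z ^+ m * b ^+ 2).
  transitivity ((a ^+ 2 - D * b ^+ 2) * d ^+ 2 - (c ^+ 2 - D * d ^+ 2) * b ^+ 2).
    by ring.
  by rewrite nabE ncdE exprD; ring.
have [pD|pD] := boolP (p %| a * d + b * c)%Z; last first.
  have [r [s [? ? ?]]] := norm_pm_quotient _ _ _ _ _ _ t0 m0 nab coab ncd cocd
    (prime_pow_dvdzM _ _ _ pprod pD).
  by exists r, s; split=> //; left.
(* Oddness of [p] enters here: the two factors add up to [2 a d], and [p] divides none of [2], [a],
   [d]. *)
have pB : ~~ (p %| a * d - b * c)%Z.
  apply/negP => pB; have : (p %| 2%:Z * (a * d))%Z.
    have -> : 2%:Z * (a * d) = (a * d + b * c) + (a * d - b * c) by ring.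
    by rewrite rpredD.
  rewrite !prime_dvdzM (negPf na) (negPf nd) !orbF dvdzE /= dvdn_prime2 //.
  by move=> /eqP p2; move: podd; rewrite p2.
(* Replacing [b] by [- b] conjugates the first number and reduces this case to the previous one. *)
have nab' : norm_pm a (- b) t by case: nab => e e2 E; exists e; rewrite // sqrrN.
have coab' : coprimez a (- b * D) by rewrite mulNr coprimezN.
rewrite mulrC in pprod.
have pD' : (p%:Z ^+ t %| a * d - - b * c)%Z.
  by rewrite mulNr opprK; exact: prime_pow_dvdzM pprod pB.
have [r [s [? ? E]]] := norm_pm_quotient _ _ _ _ _ _ t0 m0 nab' coab' ncd cocd pD'.
by exists r, s; split=> //; right; rewrite -E mulNr opprK.
Qed.

(** Nonvanishing of both parts is recovered from coprimality: [p] divides 0 but neither [a] nor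
    [b]. *)
Lemma pm_pow_normSP (u k : nat) : (0 < k)%N ->
  pm_pow_normS D u p k <->
  exists a b : int, [/\ norm_pm a b k, coprimez a (b * D) & (u%:Z %| b)%Z].
Proof.
move=> k0; split=> [[[a b] [[/= _ _ co ub] nE]]|[a [b [nab co ub]]]].
  exists a, b; split=> //.
  by case: nE => nE; [exists 1|exists (-1)]; rewrite // ?mul1r ?mulN1r.
have [na nb _] := coprimez_prime_ndvd _ _ _ k0 nab co.
exists (Zsqrtd D a b); split.
  by split=> //=; apply/eqP=> E; [move: na|move: nb]; rewrite E dvdz0.
case: nab => e /eqP; rewrite sqrf_eq1 /normzd /= => /orP[]/eqP-> ->.
  by left; rewrite mul1r.
by right; rewrite mulN1r.
Qed.

Lemma pm_pow_normSB (u t n : nat) : odd p -> (0 < t)%N -> (t < n)%N ->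
  pm_pow_normS D u p t -> pm_pow_normS D u p n -> pm_pow_normS D u p (n - t).
Proof.
move=> podd t0 tn St Sn; have m0 : (0 < n - t)%N by rewrite subn_gt0.
move: St Sn => /pm_pow_normSP-/(_ t0)[a [b [nab coab ub]]].
move=> /pm_pow_normSP-/(_ (ltn_trans t0 tn))[c [d [ncd cocd ud]]].
rewrite -(subnKC (ltnW tn)) in ncd.
have [r [s [nrs cors sE]]] := norm_pm_descent _ _ _ _ _ _ podd t0 m0 nab coab ncd cocd.
apply/pm_pow_normSP => //; exists r, s; split=> //.
have [_ nb _] := coprimez_prime_ndvd _ _ _ t0 nab coab.
(* [u] divides [b] and [d], hence [s * p ^ t]. Since [p] does not divide [b], it does not divide
   [u], so [u] divides [s]. *)
have cou : coprimez u (p%:Z ^+ t).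
  rewrite coprimezXr // coprimez_sym prime_coprimez.
  by apply: contra nb => pu; exact: dvdz_trans ub.
rewrite -(Gauss_dvdzl _ cou).
by case: sE => <-; [apply: rpredB|apply: rpredD];
  by [exact: dvdz_mull | exact: dvdz_mulr].
Qed.

End PrimePowerNorms.

Theorem lemma3p1 (D : int) (u p t n : nat)
    (D_squarefree : squarefreez D) (u_gt0 : (0 < u)%N)
    (p_prime : prime p) (p_odd : odd p)
    (t_least : least_pos (pm_pow_normS D u p) t)
    (n_gt0 : (0 < n)%N) (n_norm : pm_pow_normS D u p n) :
  (t %| n)%N.
Proof.
have [t0 St tmin] := t_least.
elim/ltn_ind: n n_gt0 n_norm => n IHn n0 Sn.
have := tmin n n0 Sn; rewrite leq_eqVlt => /predU1P[->//|tn].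
rewrite -(subnK (ltnW tn)) dvdn_addl //; apply: IHn; rewrite ?subn_gt0 //.
  by rewrite ltn_subrL t0 n0.
exact: pm_pow_normSB.
Qed.
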